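(* Let $n$ and $k$ be integers with $k \ge 1$ and $n > 2k$. For every $i = 0, 1, \dots, k-1$ there is a group isomorphism $$\mathrm{Aut}(G_i(n,k)) \cong (\mathbb{Z}_2^i \rtimes_{\varphi} S_i) \times S_{n-2i},$$ where the action $\varphi \colon S_i \to \mathrm{Aut}(\mathbb{Z}_2^i)$ is defined by $\varphi(\sigma)(x_1, \dots, x_i) = (x_{\sigma^{-1}(1)}, \dots, x_{\sigma^{-1}(i)})$, and $\mathbb{Z}_2^i \rtimes_{\varphi} S_i$ is the semidirect product with respect to $\varphi$.
   Context: A graph is a pair $G = (V(G), E(G))$ of a set $V(G)$ together with a symmetric binary relation $E(G)$ on $V(G)$ (loops allowed); $v \sim_G w$ means $(v,w) \in E(G)$. A graph homomorphism is an adjacency-preserving map of vertex sets; an isomorphism is a graph homomorphism having an inverse that is a graph homomorphism; $\mathrm{Aut}(G)$ is the group of isomorphisms $G \to G$. The categorical product $G \times H$ has vertex set $V(G) \times V(H)$, with $(v,w) \sim (v',w')$ if and only if $v \sim_G v'$ and $w \sim_H w'$. $K_2$ is the complete graph on the vertices $1,2$, and $\tau$ is its non-trivial automorphism $1 \leftrightarrow 2$. $\mathbb{Z}_2$ is the cyclic group of order $2$, and $S_n$ is the symmetric group of $[n] = \{1, \dots, n\}$. For positive integers $n > 2k$, the Kneser graph $K(n,k)$ has as vertices the $k$-element subsets of $[n]$, two of them being adjacent if and only if they are disjoint; $S_n$ acts on it by $s \mapsto \sigma(s)$. The bipartite Kneser graph is $H(n,k) = K_2 \times K(n,k)$. A bigraph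 is a graph $X$ equipped with a graph homomorphism $\varepsilon \colon X \to K_2$; an automorphism $\alpha$ of $X$ with $\alpha^2 = \mathrm{id}$ and $\varepsilon(\alpha(x)) \neq \varepsilon(x)$ for all $x \in V(X)$ is called an odd involution. For such $X$ and $\alpha$, the quotient graph $X/\alpha$ has vertex set $\{\{x, \alpha(x)\} : x \in V(X)\}$, and two vertices $p, q$ of $X/\alpha$ are adjacent if and only if there are $x \in p$ and $y \in q$ with $x \sim_X y$. The graph $H(n,k)$ is a bigraph via the projection $(j,s) \mapsto j$ to $K_2$. For $0 \le i \le \lfloor n/2 \rfloor$ let $\sigma_i = (1,2)(3,4)\cdots(2i-1,2i) \in S_n$ (with $\sigma_0 = \mathrm{id}$), and let $\tau \times \sigma_i$ be the odd involution $(j,s) \mapsto (\tau(j), \sigma_i(s))$ of $H(n,k)$. Define $G_i(n,k) = H(n,k)/(\tau \times \sigma_i)$. *)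

(* Defs.v *)
From HB Require Import structures.
From mathcomp Require Import all_boot all_order all_algebra all_fingroup.

Set Implicit Arguments.
Unset Strict Implicit.
Unset Printing Implicit Defensive.

Local Open Scope group_scope.

(* Finite graphs; loops are allowed, so adj need not be irreflexive. *)
Record graph := Graph {
  vert :> finType;
  adj : rel vert;
  adj_sym : symmetric adj }.

Definition is_hom (G H : graph) (f : G -> H) : bool :=
  [forall x, forall y, adj x y ==> adj (f x) (f y)].

Lemma is_homP (G H : graph) (f : G -> H) :
  reflect (forall x y, adj x y -> adj (f x) (f y)) (is_hom f).
Proof. exact: 'forall_'forall_implyP. Qed.

Definition is_graph_aut (G : graph) (s : {perm G}) : bool :=
  is_hom (s : G -> G) && is_hom (s^-1 : G -> G).

(* The product of {perm G} is (s * t) x = t (s x), the opposite of composition;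
   the same convention governs 'S_n below. *)
Definition graph_aut (G : graph) : {set {perm G}} :=
  [set s | is_graph_aut s].

Lemma graph_aut_group_set (G : graph) : group_set (graph_aut G).
Proof.
apply/group_setP; split=> [|s t].
  by rewrite inE /is_graph_aut invg1; apply/andP; split; apply/is_homP=> x y;
    rewrite !perm1.
rewrite !inE => /andP[/is_homP hs /is_homP hs'] /andP[/is_homP ht /is_homP ht'].
rewrite /is_graph_aut invMg; apply/andP; split; apply/is_homP=> x y xy.
  by rewrite !permM; apply/ht/hs.
by rewrite !permM; apply/hs'/ht'.
Qed.

Canonical graph_aut_group (G : graph) : {group {perm G}} :=
  Group (graph_aut_group_set G).

Section CategoricalProduct.
Variables G H : graph.

Definition prod_adj : rel (G * H)%type :=
  fun u v => adj u.1 v.1 && adj u.2 v.2.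

Lemma prod_adj_sym : symmetric prod_adj.
Proof. by move=> u v; rewrite /prod_adj adj_sym (adj_sym u.2). Qed.

Definition prod_graph : graph := Graph prod_adj_sym.

End CategoricalProduct.

(* The vertices 1 and 2 of K_2 are the elements 0 and 1 of 'I_2. *)
Lemma K2_adj_sym : symmetric (fun j l : 'I_2 => j != l).
Proof. by move=> j l; rewrite eq_sym. Qed.

Definition K2 : graph := Graph K2_adj_sym.

Definition tau : {perm K2} := tperm (ord0 : 'I_2) (ord_max : 'I_2).

Record bigraph := Bigraph {
  bigraph_graph :> graph;
  parity : bigraph_graph -> K2;
  parity_hom : is_hom parity }.

Record odd_involution (X : bigraph) := OddInvolution {
  oddinv_perm :> {perm X};
  oddinv_aut : is_graph_aut oddinv_perm;
  oddinv_invol : involutive oddinv_perm;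
  oddinv_odd : forall x, parity (oddinv_perm x) != parity x }.

Section Quotient.
Variables (X : bigraph) (alpha : odd_involution X).

Definition quotient_vert : finType :=
  {p : {set X} | p \in [set [set x; alpha x] | x : X]}.

Definition quotient_adj : rel quotient_vert :=
  fun p q => [exists x in val p, exists y in val q, adj x y].

Lemma quotient_adj_sym : symmetric quotient_adj.
Proof.
suff imp p q : quotient_adj p q -> quotient_adj q p.
  by move=> p q; apply/idP/idP; apply: imp.
case/exists_inP=> x px /exists_inP[y qy xy].
by apply/exists_inP; exists y => //; apply/exists_inP; exists x; rewrite // adj_sym.
Qed.

Definition quotient_graph : graph := Graph quotient_adj_sym.

End Quotient.

Section Kneser.
Variables n k : nat.

Definition kneser_vert : finType := {s : {set 'I_n} | #|s| == k}.

Definition kneser_adj : rel kneser_vert :=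
  fun s t => [disjoint val s & val t].

Lemma kneser_adj_sym : symmetric kneser_adj.
Proof. by move=> s t; rewrite /kneser_adj disjoint_sym. Qed.

Definition kneser : graph := Graph kneser_adj_sym.

Lemma kneser_act_proof (sigma : 'S_n) (s : kneser) :
  #|sigma @: val s| == k.
Proof. by rewrite (card_imset _ (@perm_inj _ sigma)) (valP s). Qed.

Definition kneser_act (sigma : 'S_n) (s : kneser) : kneser :=
  Sub (sigma @: val s) (kneser_act_proof sigma s).

Lemma kneser_act1 : kneser_act 1 =1 id.
Proof.
move=> s; apply: val_inj => /=; rewrite -[RHS]imset_id.
by apply: eq_imset => x; rewrite perm1.
Qed.

Lemma kneser_actM sigma rho s :
  kneser_act (sigma * rho) s = kneser_act rho (kneser_act sigma s).
Proof.
apply: val_inj => /=; rewrite -imset_comp.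
by apply: eq_imset => x; rewrite permM.
Qed.

Lemma kneser_act_adj sigma s t :
  adj (kneser_act sigma s) (kneser_act sigma t) = adj s t.
Proof.
rewrite /= /kneser_adj /= -!setI_eq0.
rewrite -(imsetI (in2W (@perm_inj _ sigma))).
by rewrite -!cards_eq0 (card_imset _ (@perm_inj _ sigma)).
Qed.

Definition bip_kneser_graph : graph := prod_graph K2 kneser.

Lemma bip_kneser_parity_hom :
  is_hom (fun u : bip_kneser_graph => u.1 : K2).
Proof. by apply/is_homP=> u v /andP[]. Qed.

Definition bip_kneser : bigraph := Bigraph bip_kneser_parity_hom.

(* The points 1, ..., n are represented by 0, ..., n - 1, so that the factor
   (2j-1, 2j) is the transposition of the even number x = 2j - 2 and its
   successor x + 1 = 2j - 1, and j <= i reads x + 1 < 2i.  The factors commute.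
   The condition x + 1 < n is automatic when 2i <= n, see sigma_E; it keeps the
   cyclic successor ordS from wrapping around for larger i. *)
Definition sigma_ (i : nat) : 'S_n :=
  \prod_(x : 'I_n | [&& ~~ odd x, x.+1 < i.*2 & x.+1 < n]) tperm x (ordS x).

Lemma ord_pred_gt0 (x : 'I_n) : 0 < x -> ord_pred x = x.-1 :> nat.
Proof.
move=> x_gt0; rewrite /= -subn1 addnC -addnBA // modnDl modn_small subn1 //.
by rewrite prednK // ltnW.
Qed.

Lemma ord_pred_eq0 (x : 'I_n) : x = 0 :> nat -> (ord_pred x).+1 = n.
Proof.
move=> x0; have n_gt0 : 0 < n := leq_ltn_trans (leq0n x) (ltn_ord x).
by rewrite /= x0 add0n modn_small ?prednK.
Qed.

Lemma prod_tperm_ordS (r : seq 'I_n) (x : 'I_n) :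
    uniq r -> all (fun y : 'I_n => ~~ odd y && (y.+1 < n)) r ->
  (\prod_(y <- r) tperm y (ordS y)) x =
    (if x \in r then ordS x
     else if ord_pred x \in r then ord_pred x else x).
Proof.
elim: r x => [|a r IHr] x /=; first by rewrite big_nil perm1.
case/andP=> ar ur /andP[/andP[ea an] ra].
have odd_notin (y : 'I_n) : odd y -> y \notin r.
  by move=> oy; apply/negP=> /(allP ra); rewrite oy.
have SaE : ordS a = a.+1 :> nat by rewrite /= modn_small.
rewrite big_cons permM IHr // !inE.
case: tpermP => [->|->|/eqP xa /eqP xSa].
- by rewrite eqxx (negPf (odd_notin _ _)) ?SaE //= ordSK (negPf ar).
- rewrite ordSK eqxx (negPf ar) -val_eqE /= modn_small // gtn_eqF //=.
  rewrite (negPf (odd_notin (ordS a) _)) ?SaE //.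
  case: ifP => // par; case: (posnP a) => [a0|a_gt0].
    by have /andP[_] := allP ra _ par; rewrite ord_pred_eq0 ?ltnn.
  have := odd_notin (ord_pred a); rewrite par ord_pred_gt0 // => no_odd.
  suff /no_odd: odd a.-1 by [].
  by move: ea; rewrite -{1}(prednK a_gt0) /= negbK.
- rewrite (negPf xa) /=; case: eqP => [pxa|//].
  by case/eqP: xSa; rewrite -pxa ord_predK.
Qed.

Lemma sigma_seqE i (x : 'I_n) :
  let P (y : 'I_n) := [&& ~~ odd y, y.+1 < i.*2 & y.+1 < n] in
  sigma_ i x = (if P x then ordS x
                else if P (ord_pred x) then ord_pred x else x).
Proof.
move=> P; rewrite /sigma_ -big_filter prod_tperm_ordS.
- by rewrite !mem_filter !mem_index_enum !andbT.
- by rewrite filter_uniq ?index_enum_uniq.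
by apply/allP=> y; rewrite mem_filter => /andP[/and3P[-> _ ->]].
Qed.

Lemma sigma_E i (x : 'I_n) : i.*2 <= n ->
  sigma_ i x = (if x < i.*2 then if odd x then x.-1 else x.+1 else x) :> nat.
Proof.
move=> le_in; rewrite sigma_seqE.
have eS : ~~ odd x -> (x.+1 < i.*2) = (x < i.*2).
  move=> ex; rewrite [RHS]leq_eqVlt; case: eqP => // xi.
  by move: ex; rewrite -[odd x]negbK -[~~ odd x]/(odd x.+1) xi odd_double.
have oP : 0 < x -> odd (ord_pred x) = ~~ odd x.
  by move=> x_gt0; rewrite ord_pred_gt0 // -[in RHS](prednK x_gt0) /= negbK.
case: (boolP (odd x)) => [ox|ex]; last first.
  rewrite eS //; case: ltnP => xi.
    have xn : x.+1 < n by apply: leq_trans le_in; rewrite eS.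
    by rewrite xn /= modn_small.
  case: ifP => // /and3P[]; case: (posnP x) => [x0|x_gt0].
    by rewrite (ord_pred_eq0 x0) ltnn.
  by rewrite oP // ex.
have x_gt0 : 0 < x by case: (val x) ox.
rewrite oP // ox (ord_pred_gt0 x_gt0) prednK // ltn_ord andbT.
by case: (x < i.*2) => //=; exact: ord_pred_gt0.
Qed.

Lemma sigma_invol i : involutive (sigma_ i).
Proof.
move=> x; rewrite [sigma_ i x]sigma_seqE; case: ifP => [|Px].
  case/and3P=> ex xi xn; have SxE : ordS x = x.+1 :> nat by rewrite /= modn_small.
  by rewrite sigma_seqE SxE oddS negbK (negPf ex) ordSK ex xi xn.
case: ifP => Ppx; first by rewrite sigma_seqE Ppx ord_predK.
by rewrite sigma_seqE Px Ppx.
Qed.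

Lemma kneser_act_sigmaK i : involutive (kneser_act (sigma_ i)).
Proof.
move=> s; rewrite -kneser_actM -[RHS]kneser_act1; congr kneser_act.
by apply/permP=> x; rewrite permM perm1 sigma_invol.
Qed.

Definition tau_sigma_fun (i : nat) (u : bip_kneser) : bip_kneser :=
  (tau u.1, kneser_act (sigma_ i) u.2).

Lemma tau_sigma_funK i : involutive (tau_sigma_fun i).
Proof. by case=> j s; rewrite /tau_sigma_fun /= tpermK kneser_act_sigmaK. Qed.

Definition tau_sigma_perm (i : nat) : {perm bip_kneser} :=
  perm (can_inj (tau_sigma_funK i)).

Lemma tau_sigma_invol i : involutive (tau_sigma_perm i).
Proof. by move=> u; rewrite !permE tau_sigma_funK. Qed.

Lemma tau_sigma_aut i : is_graph_aut (tau_sigma_perm i).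
Proof.
have hom : is_hom (tau_sigma_perm i : bip_kneser -> bip_kneser).
  apply/is_homP=> u v /andP[uv1 uv2]; rewrite !permE; apply/andP; split.
    by rewrite /= (inj_eq perm_inj).
  by rewrite kneser_act_adj.
rewrite /is_graph_aut hom /=; congr is_true: hom; apply/eq_forallb=> u.
apply: eq_forallb => v.
have E w : (tau_sigma_perm i)^-1 w = tau_sigma_perm i w.
  by apply: (@perm_inj _ (tau_sigma_perm i)); rewrite permKV tau_sigma_invol.
by rewrite !E.
Qed.

Lemma tau_sigma_odd i u : parity (tau_sigma_perm i u) != parity u.
Proof.
rewrite permE /= /tau; case: tpermP => [->|->|/eqP u0 /eqP u1] //.
by case: (u.1) u0 u1 => [[|[]]].
Qed.

Definition tau_sigma (i : nat) : odd_involution bip_kneser :=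
  OddInvolution (tau_sigma_aut i) (@tau_sigma_invol i) (@tau_sigma_odd i).

Definition G_ (i : nat) : graph := quotient_graph (tau_sigma i).

End Kneser.

Section CoordinateAction.
Variable i : nat.

Notation Z2i := {dffun forall j : 'I_i, 'Z_2}.

(* phi(s)(x)_j = x_(s^-1 j) is a left action for composition of permutations,
   that is, a right action for the product of 'S_i. *)
Definition coord_act_fun (x : Z2i) (s : 'S_i) : Z2i :=
  [ffun j => x (s^-1 j)].

Lemma coord_act_is_action : is_action setT coord_act_fun.
Proof.
apply: is_total_action => [x|x s t]; apply/ffunP=> j.
  by rewrite ffunE invg1 perm1.
by rewrite !ffunE invMg permM.
Qed.

Definition coord_action : {action 'S_i &-> Z2i} := Action coord_act_is_action.

Lemma coord_act_is_groupAction : is_groupAction [set: Z2i] coord_action.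
Proof.
move=> s _; rewrite /= inE; apply/andP; split.
  by apply/subsetP=> x; rewrite inE.
by apply/morphicP=> x y _ _; rewrite !actpermE; apply/ffunP=> j; rewrite !ffunE.
Qed.

Definition phi : groupAction [set: 'S_i] [set: Z2i] :=
  GroupAction coord_act_is_groupAction.

End CoordinateAction.

(* Main.v *)
Require Import Defs.
From mathcomp Require Import all_boot all_order all_algebra all_fingroup.
From mathcomp Require Import zify.

(** Choosing in each orbit {(1, s), (2, sigma_i s)} the element of the first part
    identifies G_i(n,k) with the graph on k-sets where s ~ t means that s is
    disjoint from sigma_i t (twisted_vertex_adj).  A permutation of the points
    that commutes with sigma_i is an automorphism of this graph; the main point
    is that there are no others, so that Aut(G_i(n,k)) is the centralizer of
    sigma_i in S_n (G_aut_isog).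

    Given an automorphism f, put g = sigma_i f sigma_i.  Then f s and g t are
    disjoint exactly when s and t are: (f, g) is an automorphism of the bipartite
    Kneser graph.  Because n > 2k, such a pair also acts on the (k+1)-sets,
    compatibly with inclusion (disjointness_perm).  An inclusion-compatible action
    on two consecutive levels of the subset lattice descends to the next lower
    level, since the sets containing a given j-set A have images with a common
    part of size j (star_center, level_embedding_down).  At the bottom it is a
    permutation p of the points, and f is the action of p on k-sets
    (level_embedding_perm).  Since a k-set is determined by the k-sets disjoint
    from it, p commutes with sigma_i (ksubset_perm_aut).

    Finally sigma_i consists of i transpositions and n - 2i fixed points.  A
    permutation commuting with it permutes the i transposed pairs, possibly
    swapping each, and permutes the fixed points independently (wreath_isog). *)

Set Implicit Arguments.
Unset Strict Implicit.
Unset Printing Implicit Defensive.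

(** * Maps between consecutive levels of the subset lattice *)

Section Levels.
Variable T : finType.
Implicit Types (A B C R W : {set T}) (f g : {set T} -> {set T}).

(** One function acts on the two levels j and j.+1 of the subset lattice at once,
    the cardinal of its argument telling them apart. *)
Definition level_embedding j f :=
  [/\ forall A, #|A| = j -> #|f A| = j,
      forall B, #|B| = j.+1 -> #|f B| = j.+1
    & forall A B, #|A| = j -> #|B| = j.+1 -> (f A \subset f B) = (A \subset B)].

Lemma card_setU1_notin A x : x \notin A -> #|x |: A| = #|A|.+1.
Proof. by move=> xA; rewrite cardsU1 xA. Qed.

Lemma exists_notin A : #|A| < #|T| -> exists x, x \notin A.
Proof.
move=> ltA; have /subsetPn[x _ xA]: ~~ ([set: T] \subset A).
  by apply: contraL ltA => /subset_leq_card; rewrite cardsT -leqNgt.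
by exists x.
Qed.

Lemma superset1P j A B : #|A| = j -> #|B| = j.+1 -> A \subset B ->
  exists2 x : T, x \notin A & B = x |: A.
Proof.
move=> hA hB AB; have : #|B :\: A| == 1 by rewrite cardsDS // hB hA subSnn.
case/cards1P=> x Bx; exists x.
  by have := set11 x; rewrite -Bx inE => /andP[].
by rewrite -(setID B A) (setIidPr AB) Bx setUC.
Qed.

(** A set is the intersection of its supersets with one more element, as soon as
    at least two points lie outside it. *)
Lemma eq_from_supersets A B :
    #|B| = #|A| -> #|A|.+1 < #|T| ->
    (forall C, #|C| = #|A|.+1 -> A \subset C -> B \subset C) ->
  B = A.
Proof.
move=> eqBA ltA AB; apply/eqP; rewrite eqEcard eqBA leqnn andbT.
apply/subsetP=> x xB; apply: contraT => xA.
have [|y] := @exists_notin (x |: A); first by rewrite card_setU1_notin.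
rewrite !inE negb_or => /andP[yx yA].
have /subsetP/(_ x xB) := AB _ (card_setU1_notin yA) (subsetUr _ _).
by rewrite !inE eq_sym (negPf yx) (negPf xA).
Qed.

Lemma card_setU_setI A B j :
  #|A| = j.+1 -> #|B| = j.+1 -> #|A :|: B| = j.+2 -> #|A :&: B| = j.
Proof. by move=> hA hB hU; have := cardsUI A B; lia. Qed.

Lemma level_embedding_inj j f A B : level_embedding j f -> j.+1 < #|T| ->
  #|A| = j -> #|B| = j -> f A = f B -> A = B.
Proof.
move=> [_ _ fS] ltj hA hB eqf; apply: eq_from_supersets => [||C hC BC].
- by rewrite hA hB.
- by rewrite hB.
- by rewrite hB in hC; rewrite -fS // eqf fS.
Qed.

(** The (j+1)-sets containing A form a star: any two lie in a common (j+2)-set,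
    but no three do.  Both facts survive f, so the images pairwise meet in j
    points while no image lies in the union of two others.  A third image then
    has exactly one point outside f (x |: A) :|: f (y |: A), so that it meets
    both sets in the same j points, those of their intersection; this
    intersection is therefore contained in all images. *)
Lemma star_center j f A : level_embedding j.+1 f -> j.+2 < #|T| -> #|A| = j ->
  exists2 R : {set T}, #|R| = j &
    forall B : {set T}, #|B| = j.+1 -> A \subset B -> R \subset f B.
Proof.
move=> fE ltj hA; have [f1 f2 fS] := fE.
have [|x xA] := @exists_notin A; first lia.
have [|y] := @exists_notin (x |: A); first by rewrite card_setU1_notin //; lia.
rewrite !inE negb_or => /andP[yx yA].
have hs z : z \notin A -> #|z |: A| = j.+1.
  by move=> zA; rewrite card_setU1_notin // hA.
have hW z t : z \notin A -> t \notin A -> z != t ->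
    #|(z |: A) :|: (t |: A)| = j.+2.
  move=> zA tA zt; rewrite -(hs _ tA) -setUA [A :|: _]setUCA setUid.
  by rewrite card_setU1_notin // !inE negb_or zt.
have hU z t : z \notin A -> t \notin A -> z != t ->
  f (z |: A) :|: f (t |: A) = f ((z |: A) :|: (t |: A)).
  move=> zA tA zt; apply/eqP; rewrite eqEcard subUset !fS ?hs ?hW //.
  rewrite subsetUl subsetUr /= f2 ?hW //.
  apply: contraT; rewrite -ltnNge ltnS => le.
  have eqU (C : {set T}) : #|C| = j.+1 -> C \subset f (z |: A) :|: f (t |: A) ->
      C = f (z |: A) :|: f (t |: A).
    by move=> hC sC; apply/eqP; rewrite eqEcard sC hC.
  have eqf : f (z |: A) = f (t |: A).
    apply: etrans (eqU _ _ (subsetUl _ _)) (esym (eqU _ _ (subsetUr _ _)));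
      by rewrite f1 ?hs.
  have neq : z |: A != t |: A.
    by apply/eqP=> /setP/(_ z); rewrite !inE eqxx (negPf zA) (negPf zt).
  have /eqP := level_embedding_inj fE ltj (hs _ zA) (hs _ tA) eqf.
  by rewrite (negPf neq).
have hI z t : z \notin A -> t \notin A -> z != t ->
  #|f (z |: A) :&: f (t |: A)| = j.
  move=> zA tA zt; apply: card_setU_setI; rewrite ?f1 ?hs //.
  by rewrite hU // f2 // hW.
exists (f (x |: A) :&: f (y |: A)); first by rewrite hI // eq_sym.
move=> B hB AB; have [z zA ->] := superset1P hA hB AB.
have [->|zx] := eqVneq z x; first exact: subsetIl.
have [->|zy] := eqVneq z y; first exact: subsetIr.
have xy : x != y by rewrite eq_sym.
(* Three members of a star do not fit into one (j+2)-set. *)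
have nsub : ~~ (f (z |: A) \subset f (x |: A) :|: f (y |: A)).
  rewrite hU // fS ?hs ?hW //; apply/subsetPn; exists z; rewrite !inE ?eqxx //.
  by rewrite (negPf zx) (negPf zy) (negPf zA).
set U := f (x |: A) :|: f (y |: A).
have small : #|f (z |: A) :&: U| <= j.
  rewrite -ltnS -(f1 _ (hs _ zA)) proper_card // properEneq subsetIl andbT.
  by apply: contra nsub => /eqP/setIidPl.
have eqI t : t \in [:: x; y] -> f (z |: A) :&: f (t |: A) = f (z |: A) :&: U.
  move=> txy; apply/eqP; rewrite eqEcard setIS /=; last first.
    by move: txy; rewrite !inE => /orP[]/eqP->; rewrite ?subsetUl ?subsetUr.
  by move: txy; rewrite !inE => /orP[]/eqP->; rewrite hI.
have : f (z |: A) :&: f (x |: A) = f (x |: A) :&: f (y |: A).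
  apply/eqP; rewrite eqEcard !hI // leqnn andbT subsetI subsetIr /=.
  by rewrite eqI ?inE ?eqxx // -(eqI y) ?inE ?eqxx ?orbT // subsetIr.
by move <-; exact: subsetIl.
Qed.

(** Send A to the center of the image of its star.  The reverse implication
    f' A \subset f B -> A \subset B is by counting: stars of j-sets all have
    #|T| - j members, so f maps the star of A onto the star of its center. *)
Lemma level_embedding_down j f : level_embedding j.+1 f -> j.+2 < #|T| ->
  exists2 f', level_embedding j f' & forall B, #|B| = j.+1 -> f' B = f B.
Proof.
move=> fE ltj; have [f1 f2 fS] := fE.
have /fin_all_exists[F hF] (A : {set T}) : exists R : {set T}, #|A| = j ->
    #|R| = j /\ forall B : {set T}, #|B| = j.+1 -> A \subset B -> R \subset f B.
  have [hA|/eqP hA] := eqVneq #|A| j; last by exists A.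
  by have [R] := star_center fE ltj hA; exists R.
exists (fun A => if #|A| == j then F A else f A); last first.
  by move=> B ->; rewrite gtn_eqF.
split=> [A hA|B hB|A B hA hB].
- by rewrite hA eqxx; case: (hF A hA).
- by rewrite hB gtn_eqF // f1.
rewrite hA hB eqxx gtn_eqF //; have [hFA FS] := hF A hA.
apply/idP/idP=> [FAB|]; last exact: FS.
pose star (C : {set T}) := [set D : {set T} | (C \subset D) && (#|D| == j.+1)].
have starE (C : {set T}) : #|C| = j -> #|star C| = #|T| - j.
  move=> hC; rewrite -hC -cardsT -cardsDS ?subsetT // setTD.
  have <- : [set x |: C | x in ~: C] = star C.
    apply/setP=> D; rewrite inE; apply/imsetP/andP=> [[x]|[CD /eqP hD]].
      by rewrite inE => xC ->; rewrite card_setU1_notin // hC eqxx subsetUr.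
    by have [x xC ->] := superset1P hC hD CD; exists x; rewrite ?inE.
  rewrite card_in_imset // => x y; rewrite !inE => xC yC /setP/(_ x).
  by rewrite !inE eqxx (negPf xC) !orbF => /esym/eqP.
have f_inj : {in [pred B : {set T} | #|B| == j.+1] &, injective f}.
  by move=> B1 B2 /eqP h1 /eqP h2; exact: level_embedding_inj fE _ _ _.
have : f B \in f @: star A.
  have -> : f @: star A = star (F A).
    apply/eqP; rewrite eqEcard card_in_imset ?starE //.
      rewrite leqnn andbT; apply/subsetP=> _ /imsetP[D + ->].
      by rewrite !inE => /andP[AD /eqP hD]; rewrite FS // f1 /=.
    by move=> B1 B2 /[!inE] /andP[_ h1] /andP[_ h2]; apply: f_inj.
  by rewrite inE FAB f1 /=.
case/imsetP=> D /[!inE] /andP[AD hD] /f_inj -> //; rewrite inE ?hB //.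
Qed.

(** Going down level by level ends at the singletons, where the map is a
    permutation p of the points.  Going back up, a set with at least two elements
    is the union of its subsets with one element less, so that f A contains, hence
    equals, p @: A. *)
Lemma level_embedding_perm j f : level_embedding j.+1 f -> j.+2 < #|T| ->
  exists p : {perm T}, forall A, #|A| = j.+1 -> f A = p @: A.
Proof.
elim: j f => [|j IHj] f fE ltj; have [f1 f2 fS] := fE.
  have /fin_all_exists[p hp] x : exists y, f [set x] = [set y].
    by apply/cards1P; rewrite f1 ?cards1.
  have p_inj : injective p.
    move=> x y eqp; apply: set1_inj; apply: (level_embedding_inj fE) => //.
    - by rewrite cards1.
    - by rewrite cards1.
    - by rewrite !hp eqp.
  exists (perm p_inj) => A /eqP/cards1P[x ->].
  by rewrite imset_set1 permE.
have [f' f'E ff'] := level_embedding_down fE ltj.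
have [p hp] := IHj f' f'E (ltnW ltj); exists p => A hA.
have [_ _ f'S] := f'E.
apply/esym/eqP; rewrite eqEcard f1 // (card_imset _ perm_inj) hA leqnn andbT.
apply/subsetP=> _ /imsetP[x xA ->].
have [y yA yx] : exists2 y, y \in A & y != x.
  have : #|A :\ x| != 0 by move: hA; rewrite (cardsD1 x) xA; lia.
  by rewrite cards_eq0 => /set0Pn[y]; rewrite !inE => /andP[yx yA]; exists y.
have hAy : #|A :\ y| = j.+1 by move: hA; rewrite (cardsD1 y) yA; lia.
have : f' (A :\ y) \subset f' A by rewrite f'S // subD1set.
rewrite hp // ff' // => /subsetP; apply; apply: imset_f.
by rewrite !inE eq_sym yx.
Qed.

End Levels.

(** * Disjointness of k-sets *)

Section Disjointness.
Variables (T : finType) (k : nat).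
Hypotheses (k_gt0 : 0 < k) (k_lt : 2 * k < #|T|).
Implicit Types (A B C W : {set T}) (f g : {set T} -> {set T}).

Lemma exists_ksubset x B : x \in B -> k <= #|B| ->
  exists C : {set T}, [/\ x \in C, C \subset B & #|C| = k].
Proof.
move=> xB kB.
have : 0 < #|[set D : {set T} | (D \subset B :\ x) && (#|D| == k.-1)]|.
  by rewrite cards_draws bin_gt0; move: kB; rewrite (cardsD1 x) xB; lia.
case/card_gt0P=> D; rewrite inE => /andP[/subsetD1P[DB xD] /eqP hD].
exists (x |: D); rewrite setU11 subUset sub1set xB DB; split=> //.
by rewrite card_setU1_notin // hD prednK.
Qed.

(** Containment in a set W of size at most #|T| - k can be tested by disjointness
    from k-sets only, because these cover the complement of W. *)
Lemma subset_disjointE A W : k <= #|~: W| ->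
  (A \subset W) =
  [forall B : {set T}, (#|B| == k) && (B \subset ~: W) ==> [disjoint A & B]].
Proof.
move=> kW; apply/idP/forall_inP=> [AW B /andP[_ BW]|H].
  apply: disjointWl AW _.
  by rewrite disjoint_sym disjoints_subset.
apply/subsetP=> x xA; apply: contraT; rewrite -in_setC => xW.
have [B [xB BW hB]] := exists_ksubset xW kW.
have := H B; rewrite hB eqxx BW => /(_ isT)/disjointFr/(_ xA).
by rewrite xB.
Qed.

Lemma bin_succ_inj m : 'C(m, k) = 'C(k.+1, k) -> m = k.+1.
Proof.
rewrite binSn => e; have km : k <= m by rewrite -bin_gt0 e.
have km' : k < m.
  by rewrite ltn_neqAle km andbT; apply/eqP=> kE; move: e; rewrite -kE binn; lia.
apply/eqP; rewrite eqn_leq km' andbT leqNgt; apply/negP=> lt.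
have : 'C(k.+2, k) <= k.+1 by rewrite -[X in _ <= X]e leq_bin2l.
have := binS k.+1 k.-1; rewrite prednK // binSn.
have : 0 < 'C(k.+1, k.-1) by rewrite bin_gt0; lia.
lia.
Qed.

(** The pair (f, g) is an automorphism of the bipartite Kneser graph that keeps
    the two parts.  Since k.+1 <= #|T| - k, a set W of size k.+1 is determined by
    the k-sets B that avoid it, and moving these by g gives a set F W for which
    f A \subset F W if and only if A \subset W.  As f is onto the k-sets, F W has as
    many k-subsets as W, hence the same size: f and F form a level embedding. *)
Lemma disjointness_perm f g :
    (forall A, #|A| = k -> #|f A| = k) ->
    {in [pred A : {set T} | #|A| == k] &, injective f} ->
    (forall A B, #|A| = k -> #|B| = k ->
       [disjoint f A & g B] = [disjoint A & B]) ->
  exists p : {perm T}, forall A, #|A| = k -> f A = p @: A.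
Proof.
move=> f1 f_inj fg.
pose F W := ~: \bigcup_(B : {set T} | (#|B| == k) && (B \subset ~: W)) g B.
have FE A W : #|A| = k -> #|W| = k.+1 -> (f A \subset F W) = (A \subset W).
  move=> hA hW; rewrite [RHS]subset_disjointE; last by have := cardsC W; lia.
  rewrite /F -disjoints_subset disjoint_sym disjoints_subset.
  have gfE B : (#|B| == k) && (B \subset ~: W) ->
      (g B \subset ~: f A) = [disjoint A & B].
    by case/andP=> /eqP hB _; rewrite -disjoints_subset disjoint_sym fg.
  by apply/bigcupsP/forall_inP=> H B BW; have := H B BW; rewrite gfE.
pose ksub W := [set A : {set T} | (A \subset W) && (#|A| == k)].
have card_ksub W : #|ksub W| = 'C(#|W|, k) by exact: cards_draws.
have f_onto C : #|C| = k -> exists2 A : {set T}, #|A| = k & f A = C.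
  pose K := ksub setT; have fK : f @: K = K.
    apply/eqP; rewrite eqEcard card_in_imset ?leqnn ?andbT.
      apply/subsetP=> _ /imsetP[A + ->]; rewrite !inE !subsetT.
      by move=> /eqP/f1->; rewrite eqxx.
    by move=> A B; rewrite !inE => /andP[_ hA] /andP[_ hB]; exact: f_inj.
  move=> hC; have : C \in K by rewrite inE subsetT hC /=.
  by rewrite -fK => /imsetP[A]; rewrite inE => /andP[_ /eqP hA] ->; exists A.
have F1 W : #|W| = k.+1 -> #|F W| = k.+1.
  move=> hW; apply: bin_succ_inj; rewrite -hW -!card_ksub.
  have <- : f @: ksub W = ksub (F W).
    apply/setP=> C; rewrite inE; apply/imsetP/andP=> [[A]|[CF /eqP hC]].
      by rewrite inE => /andP[AW /eqP hA] ->; rewrite f1 // FE.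
    have [A hA eC] := f_onto C hC.
    by exists A; rewrite // inE hA eqxx andbT -FE // eC.
  rewrite card_in_imset // => A B; rewrite !inE => /andP[_ hA] /andP[_ hB].
  exact: f_inj.
pose h A := if #|A| == k then f A else F A.
have hE : level_embedding k h.
  split=> [A hA|B hB|A B hA hB]; rewrite /h.
  - by rewrite hA eqxx f1.
  - by rewrite hB gtn_eqF // F1.
  - by rewrite hA hB eqxx gtn_eqF // FE.
have [||p hp] := @level_embedding_perm T k.-1 h; rewrite ?prednK //; first lia.
exists p => A hA; rewrite -hp ?prednK //.
by rewrite /h hA eqxx.
Qed.

Lemma perm_eq_ksets (p q : {perm T}) :
  (forall A, #|A| = k -> p @: A = q @: A) -> p = q.
Proof.
move=> pq; apply/permP=> x; apply/eqP; apply: contraT => neq.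
have xI : x \in ~: [set q^-1%g (p x)].
  rewrite !inE; apply: contra neq => /eqP e.
  by rewrite {2}e permKV.
have [|A [xA Asub hA]] := exists_ksubset xI.
  by have := cardsC [set q^-1%g (p x)]; rewrite cards1; lia.
have : p x \in q @: A by rewrite -pq // imset_f.
case/imsetP=> y yA e; have := subsetP Asub y yA.
by rewrite !inE e permK eqxx.
Qed.

(** No two vertices of the Kneser graph have the same neighbours. *)
Lemma eq_ksets A B : #|A| = k -> #|B| = k ->
  (forall C, #|C| = k -> [disjoint C & A] = [disjoint C & B]) -> A = B.
Proof.
have sub (A' B' : {set T}) : #|A'| = k -> #|B'| = k ->
    (forall C, #|C| = k -> [disjoint C & A'] = [disjoint C & B']) ->
    A' \subset B'.
  move=> hA hB AB; apply/subsetP=> x xA; apply: contraT; rewrite -in_setC => xB.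
  have [|C [xC CB hC]] := exists_ksubset xB; first by have := cardsC B'; lia.
  have := AB C hC; rewrite [RHS]disjoints_subset CB => /disjointFr/(_ xC).
  by rewrite xA.
by move=> hA hB AB; apply/eqP; rewrite eqEsubset !sub // => C hC; rewrite AB.
Qed.

End Disjointness.

(** * Conjugation by a bijection *)

Section PermTransport.
Local Open Scope group_scope.
Variables (T U : finType) (q : T -> U) (r : U -> T).
Hypotheses (qK : cancel q r) (rK : cancel r q).

Lemma transport_perm_inj (s : {perm T}) : injective (q \o s \o r).
Proof. exact: inj_comp (inj_comp (can_inj qK) perm_inj) (can_inj rK). Qed.

Definition transport_perm (s : {perm T}) : {perm U} :=
  perm (@transport_perm_inj s).

Lemma transport_permE s x : transport_perm s (q x) = q (s x).
Proof. by rewrite permE /= qK. Qed.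

Lemma transport_permM : {in setT &, {morph transport_perm : s t / s * t}}.
Proof. by move=> s t _ _; apply/permP=> u; rewrite permM !permE /= qK permM. Qed.

Canonical transport_morphism := Morphism transport_permM.

Lemma transport_perm_injm : 'injm transport_morphism.
Proof.
apply/injmP=> s t _ _ /permP eq; apply/permP=> x; apply: (can_inj qK).
by have := eq (q x); rewrite !permE /= qK.
Qed.

Lemma transport_perm_onto u : exists s, transport_perm s = u.
Proof.
have u_inj := inj_comp (inj_comp (can_inj rK) (@perm_inj _ u)) (can_inj qK).
by exists (perm u_inj); apply/permP=> x; rewrite !permE /= permE /= !rK.
Qed.

Lemma transport_isog (A : {group {perm T}}) (B : {group {perm U}}) :
  (forall s, (transport_perm s \in B) = (s \in A)) -> A \isog B.
Proof.
move=> AB; suff <- : transport_morphism @* A = B.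
  exact: sub_isog (subsetT _) transport_perm_injm.
apply/setP=> u; apply/morphimP/idP=> [[s _ sA ->] /=|uB]; first by rewrite AB.
by have [s us] := transport_perm_onto u; exists s; rewrite ?inE // -AB us.
Qed.

End PermTransport.

(** * Automorphisms of the quotient graph *)

Lemma graph_autP (G : graph) (s : {perm G}) :
  reflect (forall x y, adj (s x) (s y) = adj x y) (s \in graph_aut G).
Proof.
rewrite inE; apply: (iffP andP) => [[/is_homP hs /is_homP hs'] x y|hs].
  by apply/idP/idP=> [/hs'|/hs //]; rewrite !permK.
by split; apply/is_homP=> x y xy; rewrite ?hs // -hs !permKV.
Qed.

Lemma graph_iso_aut_isog (G H : graph) (q : G -> H) : bijective q ->
  (forall x y, adj (q x) (q y) = adj x y) -> graph_aut G \isog graph_aut H.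
Proof.
case=> r qK rK qE; apply: (@transport_isog _ _ q r qK rK) => s.
apply/graph_autP/graph_autP=> sE x y.
  by rewrite -[RHS]qE -sE !transport_permE qE.
by rewrite -(rK x) -(rK y) !transport_permE !qE.
Qed.

Lemma disjoint_imset_perm (T : finType) (p : {perm T}) (A B : {set T}) :
  [disjoint p @: A & p @: B] = [disjoint A & B].
Proof.
rewrite -!setI_eq0 -(imsetI (in2W (@perm_inj _ p))) -!cards_eq0.
by rewrite (card_imset _ (@perm_inj _ p)).
Qed.

Section TwistedKneser.
Variables (n k : nat) (sigma : 'S_n).
Hypothesis sigmaK : involutive sigma.

(** Adjacency of the quotient of K_2 x K(n,k) by tau x sigma, read on the
    representatives in the first part. *)
Definition twisted_adj : rel (kneser_vert n k) :=
  fun s t => [disjoint val s & sigma @: val t].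

Lemma imset_invol (A : {set 'I_n}) : sigma @: (sigma @: A) = A.
Proof.
by rewrite -imset_comp -[RHS]imset_id; apply: eq_imset => x; exact: sigmaK.
Qed.

Lemma twisted_adj_sym : symmetric twisted_adj.
Proof.
move=> s t; rewrite /twisted_adj disjoint_sym -(disjoint_imset_perm sigma).
by rewrite imset_invol.
Qed.

Definition twisted_kneser : graph := Graph twisted_adj_sym.

Hypotheses (k_gt0 : 0 < k) (n_gt2k : 2 * k < n).

Lemma card_n_gt2k : 2 * k < #|'I_n|. Proof. by rewrite card_ord. Qed.

Lemma kneser_act_inj (p : 'S_n) : injective (@kneser_act n k p).
Proof.
apply: (can_inj (g := @kneser_act n k p^-1%g)) => s.
by rewrite -kneser_actM mulgV kneser_act1.
Qed.

Definition ksubset_perm (p : 'S_n) : {perm twisted_kneser} :=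
  perm (@kneser_act_inj p).

Lemma ksubset_permM :
  {in setT &, {morph ksubset_perm : p r / (p * r)%g}}.
Proof.
by move=> p r _ _; apply/permP=> s; rewrite permM !permE kneser_actM.
Qed.

Canonical ksubset_morphism := Morphism ksubset_permM.

Lemma val_ksubset_perm p s : val (ksubset_perm p s) = p @: val s.
Proof. by rewrite permE. Qed.

Lemma ksubset_perm_injm : ('injm ksubset_morphism)%g.
Proof.
apply/injmP=> p r _ _ /permP eq; apply: (perm_eq_ksets k_gt0 card_n_gt2k).
move=> A /eqP hA; have := congr1 val (eq (Sub A hA)).
by rewrite /= !val_ksubset_perm.
Qed.

(** With g = sigma f sigma, the pair (f, g) preserves disjointness of k-sets. *)
Lemma twisted_aut_induced (f : {perm twisted_kneser}) :
  f \in graph_aut twisted_kneser -> exists p, f = ksubset_perm p.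
Proof.
move=> /graph_autP fE.
have {}fE (s t : kneser_vert n k) :
    [disjoint val (f s) & sigma @: val (f t)] = [disjoint val s & sigma @: val t].
  exact: fE.
pose F (A : {set 'I_n}) := if insub A is Some s then val (f s) else A.
have FE s : F (val s) = val (f s) by rewrite /F valK.
pose G (A : {set 'I_n}) := sigma @: F (sigma @: A).
have lift (A : {set 'I_n}) : #|A| = k -> exists s : kneser_vert n k, A = val s.
  by move/eqP=> hA; exists (Sub A hA).
have [A hA|A B|A B hA hB|p hp] := @disjointness_perm _ k k_gt0 card_n_gt2k F G.
- by have [s ->] := lift A hA; rewrite FE; apply/eqP/(valP (f s)).
- rewrite !inE => /eqP/lift[s ->] /eqP/lift[t ->]; rewrite !FE.
  by move/val_inj/perm_inj->.
- have [s ->] := lift A hA; have [|t tE] := lift (sigma @: B).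
    by rewrite (card_imset _ (@perm_inj _ sigma)).
  by rewrite /G tE !FE fE -tE imset_invol.
exists p; apply/permP=> s; apply: val_inj; rewrite val_ksubset_perm -FE hp //.
exact/eqP/(valP s).
Qed.

(** If p acts as an automorphism then p sigma(A) and sigma(p(A)) are disjoint from
    the same k-sets, for every k-set A, hence they are equal, and an element of
    S_n is determined by its action on k-sets. *)
Lemma ksubset_perm_aut p :
  (ksubset_perm p \in graph_aut twisted_kneser) = (p \in 'C[sigma]%g).
Proof.
have pE s t : adj (ksubset_perm p s) (ksubset_perm p t) =
    [disjoint p @: val s & sigma @: (p @: val t)].
  by rewrite /= /twisted_adj !val_ksubset_perm.
apply/graph_autP/cent1P=> [pA|pC s t].
  apply: (perm_eq_ksets k_gt0 card_n_gt2k) => A hA.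
  have card_im (r : 'S_n) (B : {set 'I_n}) : #|r @: B| = #|B|.
    exact: card_imset (@perm_inj _ r).
  have imM (r r' : 'S_n) (B : {set 'I_n}) : (r * r')%g @: B = r' @: (r @: B).
    by rewrite -imset_comp; apply: eq_imset => x; rewrite permM.
  apply: (eq_ksets k_gt0 card_n_gt2k); rewrite ?card_im // => C hC.
  have [D hD ->] : exists2 D : {set 'I_n}, #|D| = k & C = p @: D.
    exists (p^-1%g @: C); first by rewrite card_im.
    rewrite -imM mulVg -[LHS]imset_id.
    by apply: eq_imset => x; rewrite perm1.
  rewrite !imM disjoint_imset_perm.
  move/eqP: hA => hA; move/eqP: hD => hD.
  by have := pA (Sub D hD) (Sub A hA); rewrite pE.
rewrite pE -imset_comp (_ : _ @: val t = p @: (sigma @: val t)).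
  by rewrite disjoint_imset_perm.
by rewrite -imset_comp; apply: eq_imset => x; rewrite /= -!permM pC.
Qed.

Lemma twisted_aut_isog : graph_aut twisted_kneser \isog 'C[sigma]%g.
Proof.
rewrite isog_sym /=; suff -> : graph_aut twisted_kneser =
    (ksubset_morphism @* 'C[sigma])%g.
  exact: sub_isog (subsetT _) ksubset_perm_injm.
apply/setP=> f; apply/idP/morphimP=> [fA|[p _ pC ->]].
  have [p fE] := twisted_aut_induced fA; exists p; first exact: in_setT.
    by rewrite -ksubset_perm_aut -fE.
  exact: fE.
by rewrite /= ksubset_perm_aut.
Qed.

End TwistedKneser.

Section QuotientModel.
Variables n k i : nat.

Let sigmaK := @sigma_invol n i.

Lemma tau_sigmaE (u : bip_kneser n k) :
  tau_sigma n k i u = (tau u.1, kneser_act (sigma_ n i) u.2).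
Proof. exact: permE. Qed.

Lemma orbit_subproof (u : bip_kneser n k) :
  [set u; tau_sigma n k i u] \in
    [set [set x; tau_sigma n k i x] | x : bip_kneser n k].
Proof. exact: imset_f. Qed.

Definition twisted_vertex (s : twisted_kneser k sigmaK) : G_ n k i :=
  exist (fun p : {set bip_kneser n k} => is_true (p \in _)) _
    (orbit_subproof (ord0, s)).

Lemma in_twisted_vertex (u : bip_kneser n k) s :
  (u \in val (twisted_vertex s)) =
  (u == (ord0, s)) || (u == (ord_max, kneser_act (sigma_ n i) s)).
Proof. by rewrite !inE tau_sigmaE /= tpermL. Qed.

Lemma twisted_vertex_bij : bijective twisted_vertex.
Proof.
have inj : injective twisted_vertex.
  move=> s t /(congr1 val)/setP/(_ (ord0, s)).
  by rewrite !in_twisted_vertex eqxx !xpair_eqE /= orbF => /esym/eqP.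
have /fin_all_exists[r rK] (p : G_ n k i) : exists s, twisted_vertex s = p.
  have /imsetP[[j s] _ pE] := valP p.
  have [j0|j1] := eqVneq j ord0.
    by exists s; apply: val_inj; rewrite pE j0.
  have {}j1 : j = ord_max by apply/val_inj; case: j j1 {pE} => [[|[]]].
  exists (kneser_act (sigma_ n i) s); apply: val_inj; rewrite pE j1 /=.
  by rewrite !tau_sigmaE /= tpermL tpermR kneser_act_sigmaK setUC.
by exists r => // s; apply: inj; rewrite rK.
Qed.

Lemma twisted_vertex_adj s t :
  adj (twisted_vertex s) (twisted_vertex t) = adj s t.
Proof.
apply/exists_inP/idP=> [[u us /exists_inP[v vt]]|st].
  move: us vt; rewrite !in_twisted_vertex.
  case/orP=> /eqP-> /orP[]/eqP-> /andP[] //= _ d.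
  by rewrite /= twisted_adj_sym // /twisted_adj disjoint_sym.
exists (ord0, s); first by rewrite in_twisted_vertex eqxx.
apply/exists_inP; exists (ord_max, kneser_act (sigma_ n i) t) => //.
by rewrite in_twisted_vertex eqxx orbT.
Qed.

Lemma G_aut_isog : 0 < k -> 2 * k < n ->
  graph_aut (G_ n k i) \isog 'C[sigma_ n i]%g.
Proof.
move=> k_gt0 n_gt2k; apply: isog_trans (twisted_aut_isog _ k_gt0 n_gt2k).
rewrite isog_sym.
exact: graph_iso_aut_isog twisted_vertex_bij twisted_vertex_adj.
Qed.

End QuotientModel.

(** * The centralizer of a product of disjoint transpositions *)

Section Wreath.
Local Open Scope group_scope.
Variables i m : nat.

Let point : finType := ('I_i * 'Z_2 + 'I_m)%type.
Let wreath : finGroupType := (sdprod_by (phi i) * 'S_m)%type.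
Let z1 : 'Z_2 := ord_max.

(** The element (s, x) of the semidirect product is s followed by x, so the
    fibre over j moves to the fibre over s j and is then translated by x (s j). *)
Definition wreath_fun (g : wreath) (z : point) : point :=
  match z with
  | inl (j, b) => inl (g.1.1 j, b * g.1.2 (g.1.1 j))
  | inr c => inr (g.2 c)
  end.

Lemma inl_pair_inj (j l : 'I_i) (b d : 'Z_2) :
  inl (j, b) = inl (l, d) :> point -> j = l /\ b = d.
Proof. by move=> e; split; congruence. Qed.

Lemma inr_inj (c d : 'I_m) : inr c = inr d :> point -> c = d.
Proof. by move=> e; congruence. Qed.

Lemma wreath_fun_inj g : injective (wreath_fun g).
Proof.
case=> [[j b]|c] [[l d]|e] //=.
  by case/inl_pair_inj=> /perm_inj-> /mulIg ->.
by move/inr_inj/perm_inj->.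
Qed.

Definition wreath_perm g : {perm point} := perm (@wreath_fun_inj g).

Lemma wreath_permE g z : wreath_perm g z = wreath_fun g z.
Proof. exact: permE. Qed.

Lemma wreath_permM : {in setT &, {morph wreath_perm : g h / g * h}}.
Proof.
move=> g h _ _; apply/permP=> z; rewrite permM !wreath_permE.
case: z => [[j b]|c] /=; last by rewrite permM.
by rewrite permM mulg_ffun ffunE permK mulgA.
Qed.

Canonical wreath_morphism := Morphism wreath_permM.

Lemma wreath_perm_injm : 'injm wreath_morphism.
Proof.
apply/injmP=> g h _ _ /permP eq.
have eqs : g.1.1 = h.1.1.
  apply/permP=> j; have := eq (inl (j, 1)).
  by rewrite !wreath_permE /= => /inl_pair_inj[].
have eqx : g.1.2 = h.1.2.
  apply/ffunP=> j; have := eq (inl (g.1.1^-1 j, 1)).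
  by rewrite !wreath_permE /= -eqs permKV => /inl_pair_inj[_ /mulgI].
have equ : g.2 = h.2.
  by apply/permP=> c; have := eq (inr c); rewrite !wreath_permE /= => /inr_inj.
case: g h eqs eqx equ {eq} => [[[s x] gP] u] [[[t y] hP] v] /= eqs eqx ->.
by congr (_, _); apply: val_inj; rewrite /= eqs eqx.
Qed.

(** The model of sigma_i: the two points of each fibre are swapped and the
    remaining points are fixed. *)
Definition flip_fun (z : point) : point :=
  match z with inl (j, b) => inl (j, b * z1) | inr c => inr c end.

Lemma flip_funK : involutive flip_fun.
Proof.
case=> [[j b]|c] //=.
by rewrite -mulgA [z1 * _](_ : _ = 1) ?mulg1 //; exact: val_inj.
Qed.

Definition flip : {perm point} := perm (can_inj flip_funK).

Lemma Z2_cases (b : 'Z_2) : b = 1 \/ b = z1.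
Proof. by case: b => [[|[]]] // b; [left | right]; apply: val_inj. Qed.

(** A permutation p commuting with flip preserves the fixed points of flip, which
    gives u, and permutes the fibres.  It is determined on the fibre over j by the
    image (s j, x j) of (j, 1). *)
Lemma wreath_isog : setX [set: sdprod_by (phi i)] [set: 'S_m] \isog 'C[flip].
Proof.
suff <- : wreath_morphism @* setX setT setT = 'C[flip].
  exact: sub_isog (subsetT _) wreath_perm_injm.
apply/setP=> p; apply/morphimP/cent1P=> [[g _ _ ->]|pC].
  apply/permP=> z; rewrite !permM /flip !(permE, wreath_permE).
  case: z => [[j b]|c] //=; congr (inl (_, _)).
  by rewrite -!mulgA; congr (_ * _); exact: Zp_mulgC.
have pF z : p (flip_fun z) = flip_fun (p z).
  by have /permP/(_ z) := pC; rewrite !permM /flip !permE.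
have flipN j b : flip_fun (inl (j, b)) <> inl (j, b).
  by case/inl_pair_inj=> _; rewrite -{2}[b]mulg1 => /mulgI/(congr1 val).
have /fin_all_exists[u uE] c : exists d, p (inr c) = inr d.
  have := pF (inr c); case: (p (inr c)) => [[j b]|d]; last by exists d.
  by move/esym/flipN.
have /fin_all_exists[s /fin_all_exists[x sxE]] j :
    exists l, exists b, p (inl (j, 1)) = inl (l, b).
  case pj: (p (inl (j, 1))) => [[l b]|c]; first by exists l, b.
  by case: (@flipN j 1); apply: (@perm_inj _ p); rewrite pF pj.
have pE j b : p (inl (j, b)) = inl (s j, b * x j).
  have [->|bz] := Z2_cases b; first by rewrite mul1g.
  rewrite [b * _]Zp_mulgC bz -[z1 in LHS]mul1g.
  by rewrite -[inl (j, _)]/(flip_fun (inl (j, 1))) pF sxE.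
have s_inj : injective s.
  (* The translate of (l, 1) in its fibre by x j - x l has the same image as
     (j, 1). *)
  move=> j l sjl; have : p (inl (j, 1)) = p (inl (l, (x j * (x l)^-1))).
    by rewrite !pE mul1g mulgKV sjl.
  by move/perm_inj/inl_pair_inj=> [].
have u_inj : injective u.
  move=> c d ucd; apply: inr_inj; apply: (@perm_inj _ p).
  by rewrite !uE ucd.
pose sp := perm s_inj.
(* wreath_fun translates after moving the fibre, hence the inverse of sp. *)
pose xf : {dffun forall j : 'I_i, 'Z_2} := [ffun j => x (sp^-1 j)].
have gP : (sp, xf) \in setX [set: 'S_i] [set: {dffun forall j : 'I_i, 'Z_2}].
  by rewrite !inE.
exists (SdPair (phi i) gP, perm u_inj); rewrite ?inE //.
apply/permP=> z; rewrite wreath_permE; case: z => [[j b]|c] /=.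
  by rewrite pE ffunE permK permE.
by rewrite uE permE.
Qed.

End Wreath.

Section Points.
Variables n i : nat.
Hypothesis le_2i_n : 2 * i <= n.
Let m := n - 2 * i.

(** The fibre over j is the pair 2 j, 2 j + 1 swapped by sigma_i. *)
Definition point_val (z : 'I_i * 'Z_2 + 'I_m) : nat :=
  match z with inl (j, b) => 2 * j + b | inr c => 2 * i + c end.

Lemma point_val_lt z : point_val z < n.
Proof.
case: z => [[j b]|c] /=; last by have := ltn_ord c; rewrite /m; lia.
by have := ltn_ord j; have : b < 2 := ltn_ord b; lia.
Qed.

Definition point_ord (z : 'I_i * 'Z_2 + 'I_m) : 'I_n := Ordinal (point_val_lt z).

Lemma point_ord_inj : injective point_ord.
Proof.
move=> z w /(congr1 val) /=; case: z w => [[j b]|c] [[l d]|e] /= eq.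
- have hb : b < 2 := ltn_ord b; have hd : d < 2 := ltn_ord d.
  by congr (inl (_, _)); apply: val_inj => /=; lia.
- by have := ltn_ord j; have : b < 2 := ltn_ord b; lia.
- by have := ltn_ord l; have : d < 2 := ltn_ord d; lia.
- by congr inr; apply: val_inj; apply: addnI eq.
Qed.

Lemma point_ord_bij : bijective point_ord.
Proof.
apply: inj_card_bij point_ord_inj _.
by rewrite card_sum card_prod !card_ord /m /=; lia.
Qed.

Lemma sigma_point_ord z : sigma_ n i (point_ord z) = point_ord (flip i m z).
Proof.
apply: val_inj; rewrite [LHS]sigma_E -?mul2n // permE /=.
case: z => [[j b]|c] /=; last by rewrite ltnNge leq_addr.
rewrite (_ : _ < _); last by have := ltn_ord j; have : b < 2 := ltn_ord b; lia.
rewrite oddD oddM /=; case: b => [[|[|//]]] ? /=.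
  by rewrite addn0 -[RHS]/(2 * j + 1) addn1.
by rewrite addn1 -[RHS]/(2 * j + 0) addn0.
Qed.

Lemma cent_sigma_isog :
  'C[sigma_ n i] \isog setX [set: sdprod_by (phi i)] [set: 'S_m].
Proof.
rewrite isog_sym; apply: isog_trans (wreath_isog _ _) _.
have [r qK rK] := point_ord_bij; apply: (@transport_isog _ _ _ _ qK rK) => p.
have <- : transport_perm qK rK (flip i m) = sigma_ n i.
  by apply/permP=> x; rewrite -(rK x) transport_permE sigma_point_ord.
apply/cent1P/cent1P; rewrite /commute -!transport_permM ?inE //.
  by move/(injmP (transport_perm_injm qK rK)); apply; rewrite inE.
by move->.
Qed.

End Points.

Theorem theorem2 (n k i : nat) (k_ge1 : 1 <= k) (n_gt2k : 2 * k < n)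
    (i_lt_k : i < k) :
  graph_aut (G_ n k i)
    \isog setX [set: sdprod_by (phi i)] [set: 'S_(n - 2 * i)].
Proof.
apply: isog_trans (G_aut_isog i k_ge1 n_gt2k) _.
by apply: cent_sigma_isog; lia.
Qed.
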